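(* Let $A,B\in\mathcal{L}(\mathcal{H})$ be positive operators with closed ranges. Then any two of the following conditions imply the third: (1) $A\leq B$; (2) $B^\dagger\leq A^\dagger$; (3) $\mathcal{R}(A)\cap\mathcal{N}(B)=\mathcal{R}(B)\cap\mathcal{N}(A)=\{0\}$.
   Context: $\mathcal{H}$ is a complex Hilbert space, $\mathcal{L}(\mathcal{H})$ is the algebra of bounded linear operators on $\mathcal{H}$, and $\mathcal{R}(T)$, $\mathcal{N}(T)$ denote range and nullspace. Positive means positive semidefinite, and $\leq$ is the L\''owner order on Hermitian operators: $A\leq B$ if and only if $B-A$ is positive. For $T\in\mathcal{L}(\mathcal{H})$ with closed range, $T^\dagger\in\mathcal{L}(\mathcal{H})$ is the Moore-Penrose inverse, i.e. the unique $X$ with $TXT=T$, $XTX=X$, $(TX)^*=TX$, $(XT)^*=XT$. *)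

(* Defs.v *)
From HB Require Import structures.
From mathcomp Require Import all_boot all_order all_algebra.
From mathcomp Require Import sesquilinear complex.
From mathcomp Require Import all_classical all_reals all_analysis.

Set Implicit Arguments.
Unset Strict Implicit.
Unset Printing Implicit Defensive.

Import Order.TTheory GRing.Theory Num.Theory.
Import numFieldNormedType.Exports.

Local Open Scope classical_set_scope.
Local Open Scope complex_scope.
Local Open Scope ring_scope.

(* The norm of [H] is required to be the one induced by the inner product, so
   that [H] is complete for the latter; this also makes the inner product
   positive definite. *)
HB.mixin Record CompleteNormedModule_isHilbert (R : realType) H
    of CompleteNormedModule R[i] H := {
  inner : H -> H -> R[i];
  inner_linearl : forall (a : R[i]) (x y z : H),
    inner (a *: x + y) z = a * inner x z + inner y z;
  inner_conj : forall x y : H, inner x y = (inner y x)^*;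
  inner_norm : forall x : H, inner x x = `|x| ^+ 2
}.

#[short(type="hilbertType")]
HB.structure Definition Hilbert (R : realType) :=
  {H of CompleteNormedModule R[i] H & CompleteNormedModule_isHilbert R H}.

Reserved Notation "''[' u , v ]" (format "''[' u ,  v ]").
Notation "''[' u , v ]" := (inner u%R v%R) : ring_scope.

Section InnerProduct.
Context {R : realType} {H : hilbertType R}.

Lemma inner_bilinear :
  bilinear_for *%R (@Num.conj R[i] \; *%R) (@inner R H).
Proof.
split=> [z a x y|z a x y]; first exact: inner_linearl.
rewrite /= (inner_conj z x) (inner_conj z y) -rmorphM -rmorphD -inner_linearl.
exact: inner_conj.
Qed.

HB.instance Definition _ :=
  bilinear_isBilinear.Build R[i] H H R[i] *%R (@Num.conj R[i] \; *%R)
    (@inner R H) inner_bilinear.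

Lemma inner_hermitian (x y : H) : '[x, y] = (-1) ^+ false * '[y, x]^*.
Proof. by rewrite expr0 mul1r inner_conj. Qed.

HB.instance Definition _ :=
  isHermitianSesquilinear.Build R[i] H false (@Num.conj R[i]) (@inner R H)
    inner_hermitian.

Lemma inner_gt0 (x : H) : x != 0 -> 0 < '[x, x].
Proof. by move=> x0; rewrite inner_norm exprn_gt0 // normr_gt0. Qed.

HB.instance Definition _ := isDotProduct.Build R[i] H (@inner R H) inner_gt0.

End InnerProduct.

Section BoundedOperators.
Context {R : realType} {H : hilbertType R}.

Record boundedOp := BoundedOp {
  op_fun :> {linear H -> H};
  op_bounded : exists M : R, forall x : H, `|op_fun x| <= M%:C * `|x|
}.

HB.instance Definition _ := gen_eqMixin boundedOp.
HB.instance Definition _ := gen_choiceMixin boundedOp.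

Lemma zero_op_bounded :
  exists M : R, forall x : H, `|(\0 : {linear H -> H}) x| <= M%:C * `|x|.
Proof. by exists 0 => x; rewrite /= normr0 mul0r. Qed.

Definition zero_op : boundedOp := BoundedOp zero_op_bounded.

(* [T^* = T], where the adjoint [T^*] is characterized by
   ['[T x, y] = '[x, T^* y]]. *)
Definition hermitian_op (T : H -> H) := forall x y : H, '[T x, y] = '[x, T y].

(* In [R[i]], [0 <= z] says that [z] is real and nonnegative. *)
Definition positive_op (T : H -> H) :=
  hermitian_op T /\ forall x : H, 0 <= '[T x, x].

Definition loewner (S T : H -> H) := positive_op (T \- S).

Definition nullspace (T : H -> H) : set H := [set x | T x = 0].

Definition is_mpinv (T X : boundedOp) :=
  [/\ T \o X \o T =1 T, X \o T \o X =1 X,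
      hermitian_op (T \o X) & hermitian_op (X \o T)].

(* The Moore-Penrose inverse; the value is the junk [zero_op] when there is no
   [X] with [is_mpinv T X], i.e. when the range of [T] is
   not closed. *)
Definition mpinv (T : boundedOp) : boundedOp := xget zero_op (is_mpinv T).

Lemma boundedOp_eq (S T : boundedOp) : S =1 T -> S = T.
Proof.
case: S T => [S HS] [T HT] /= ST.
have {}ST : S = T.
  case: S T ST {HS HT} => [s [[sa] [sl]]] [t [[ta] [tl]]] /= st.
  have {}st : s = t by apply: funext.
  by subst t; rewrite (Prop_irrelevance sa ta) (Prop_irrelevance sl tl).
by subst T; rewrite (Prop_irrelevance HS HT).
Qed.

Lemma inner_inj (u v : H) : (forall y, '[u, y] = '[v, y]) -> u = v.
Proof.
move=> uv; apply/eqP; rewrite -subr_eq0 -normr_eq0 -sqrf_eq0 -inner_norm.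
by rewrite linearBl /= uv subrr.
Qed.

Lemma is_mpinv_uniq (T X Y : boundedOp) : is_mpinv T X -> is_mpinv T Y -> X = Y.
Proof.
rewrite /is_mpinv /hermitian_op /eqfun /= => -[X1 X2 X3 X4] [Y1 Y2 Y3 Y4].
have TXY z : T (X z) = T (Y z).
  by apply: inner_inj => v; rewrite -(Y1 (X z)) Y3 X3 X1 Y3.
have XYT z : X (T z) = Y (T z).
  by apply: inner_inj => v; rewrite -(Y1 z) X4 Y4 X1 -Y4 Y1.
by apply: boundedOp_eq => u; rewrite -(X2 u) TXY XYT Y2.
Qed.

Lemma mpinvE (T X : boundedOp) : is_mpinv T X -> mpinv T = X.
Proof.
move=> TX; rewrite /mpinv; case: xgetP => [Y _ TY|/(_ X)//].
exact: is_mpinv_uniq TY TX.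
Qed.

End BoundedOperators.

Arguments boundedOp {R} H.

(* Main.v *)
Require Import Defs.
From HB Require Import structures.
From mathcomp Require Import all_boot all_order all_algebra.
From mathcomp Require Import complex ring lra.
From mathcomp Require Import all_classical all_reals all_analysis.
Import Order.TTheory GRing.Theory Num.Theory.
Import numFieldNormedType.Exports.

Set Implicit Arguments.
Unset Strict Implicit.
Unset Printing Implicit Defensive.

Local Open Scope classical_set_scope.
Local Open Scope complex_scope.
Local Open Scope ring_scope.

(** Write [X], [Y] for the Moore-Penrose inverses of [A], [B].

    Order reversal.  If [0 <= A <= B], then [N(B)] is contained in [N(A)], since
    a vector on which the quadratic form of a positive operator vanishes is
    killed by the operator ([loewner_null]).  If [R(B)] meets [N(A)] trivially,
    the reverse inclusion holds as well ([loewner_null_sub]), so [A] and [B]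
    have the same null space, and [A X] and [B Y] are the same orthogonal
    projection.  Put [u = Y x], [v = X x], so that [A v = B u].  Then
    [<X x, x> = <A v, v>] and [<Y x, x> = <B u, u>], and
      [0 <= <A (u - v), u - v> = <A u, u> - 2 <B u, u> + <A v, v>
         <= <A v, v> - <B u, u>],
    which is [Y <= X] ([loewner_mpinv]).  Since [A] is in turn the
    Moore-Penrose inverse of [X], and [X] has the range and null space of [A],
    the same lemma applied to [Y <= X] gives back [A <= B].  Finally, if both
    [A <= B] and [Y <= X], then [N(B)] is contained in [N(A)] and
    [N(A) = N(X)] in [N(Y) = N(B)]; the null spaces agree, and each range is
    orthogonal to its null space, so both intersections are trivial.

    Existence of the inverse.  All of the above needs [X] and [Y] to be actual
    Moore-Penrose inverses, hence that a hermitian operator [A] with closed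
    range has one ([hermitian_mpinv_exists]).  A gliding hump argument shows
    that [A] is bounded below on its range ([closed_range_bounded_below]).
    Consequently [m |-> m - t A (A m)] is a contraction of the range for small
    [t > 0], and the fixed-point iteration it suggests solves [A m = y] with
    both [m] and [y] in the range ([closed_range_onto]).  So [A] restricts to a
    bijection of its range with bounded inverse, and [X x] is the unique [m] in
    the range with [A (A m) = A x]. *)

(** * Real inner product *)

Section RealInner.
Context {R : realType} {H : hilbertType R}.
Implicit Types x y z : H.

(** Estimates and quadratic expansions are done in the underlying real Hilbert
    space, where they are inequalities between elements of the ordered field
    [R]. *)
Definition rinner x y : R := complex.Re '[x, y].
Definition rnorm x : R := complex.Re `|x|.

Lemma normE x : `|x| = (rnorm x)%:C.
Proof. by rewrite /rnorm RRe_real// ger0_real. Qed.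

Lemma rnorm_ge0 x : 0 <= rnorm x.
Proof. by rewrite -ler0c -normE. Qed.

Lemma rnorm_sqr x : rnorm x ^+ 2 = rinner x x.
Proof. by rewrite /rinner inner_norm normE -rmorphXn. Qed.

Lemma rinnerC x y : rinner x y = rinner y x.
Proof. by rewrite /rinner inner_conj; case: '[y, x]. Qed.

Lemma rinnerDl x y z : rinner (x + y) z = rinner x z + rinner y z.
Proof. by rewrite /rinner linearDl raddfD. Qed.

Lemma rinnerDr x y z : rinner x (y + z) = rinner x y + rinner x z.
Proof. by rewrite /rinner linearDr raddfD. Qed.

Lemma rinnerZl (t : R) x y : rinner (t%:C *: x) y = t * rinner x y.
Proof.
rewrite /rinner linearZl_LR /=; case: '[x, y] => a b /=.
by rewrite mul0r subr0.
Qed.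

Lemma rinnerZr (t : R) x y : rinner x (t%:C *: y) = t * rinner x y.
Proof. by rewrite rinnerC rinnerZl rinnerC. Qed.

Lemma rinnerNl x y : rinner (- x) y = - rinner x y.
Proof. by rewrite /rinner linearNl raddfN. Qed.

Lemma rinnerNr x y : rinner x (- y) = - rinner x y.
Proof. by rewrite /rinner linearNr raddfN. Qed.

Definition rinnerE :=
  (rinnerDl, rinnerDr, rinnerNl, rinnerNr, rinnerZl, rinnerZr).

Lemma rnorm0 : rnorm 0 = 0.
Proof. by rewrite /rnorm normr0. Qed.

Lemma rnorm_eq0 x : rnorm x = 0 -> x = 0.
Proof. by move=> x0; apply: normr0_eq0; rewrite normE x0. Qed.

Lemma rnormD x y : rnorm (x + y) <= rnorm x + rnorm y.
Proof. by rewrite -lecR rmorphD /= -!normE ler_normD. Qed.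

Lemma rnormN x : rnorm (- x) = rnorm x.
Proof. by rewrite /rnorm normrN. Qed.

Lemma rnorm_distC x y : rnorm (x - y) = rnorm (y - x).
Proof. by rewrite -rnormN opprB. Qed.

Lemma rnormZ (t : R) x : rnorm (t%:C *: x) = `|t| * rnorm x.
Proof.
apply: complexI; rewrite -normE normrZ normE rmorphM /=; congr (_ * _).
by rewrite normc_def /= expr0n addr0 sqrtr_sqr.
Qed.

(** Cauchy-Schwarz, from the triangle inequality that the norm of [H] already
    satisfies: square it and cancel. *)
Lemma rinner_le x y : rinner x y <= rnorm x * rnorm y.
Proof.
have := rnormD x y.
rewrite -ler_sqr ?nnegrE ?addr_ge0 ?rnorm_ge0// sqrrD !rnorm_sqr !rinnerE.
rewrite (rinnerC y x); lra.
Qed.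

(** * Geometric convergence *)

Lemma geometric_to0 (c q : R) : 0 <= q < 1 -> c * q ^+ n @[n --> \oo] --> 0.
Proof.
move=> /andP[q0 q1]; rewrite -(mulr0 c).
by apply: cvgMr; apply: cvg_expr; rewrite ger0_norm.
Qed.

Lemma le_geometric_le0 (a c q : R) :
  0 <= q < 1 -> (forall n, a <= c * q ^+ n) -> a <= 0.
Proof.
move=> /(@geometric_to0 c) cq aq; rewrite -(cvg_lim _ cq)//.
by apply: limr_ge; [apply/cvg_ex; exists 0|exact: nearW].
Qed.

(** Completeness in the quantitative form that both constructions below use: the
    explicit distance from the limit matters as much as its existence. *)
Lemma geometric_cvg (M : set H) (u : nat -> H) (c q : R) :
  closed M -> (forall n, M (u n)) -> 0 <= q < 1 ->
  (forall n, rnorm (u n.+1 - u n) <= c * q ^+ n) ->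
  exists2 l, M l & forall n, rnorm (l - u n) <= c * q ^+ n / (1 - q).
Proof.
move=> clM uM q01 uq; have /andP[q0 q1] := q01.
have q1' : 0 < 1 - q by rewrite subr_gt0.
have c0 : 0 <= c.
  by have := le_trans (rnorm_ge0 _) (uq 0%N); rewrite expr0 mulr1.
have tail n k : rnorm (u (n + k)%N - u n) <= c * q ^+ n / (1 - q).
  suff: rnorm (u (n + k)%N - u n) <= c * q ^+ n * (1 - q ^+ k) / (1 - q).
    move/le_trans; apply; rewrite ler_pM2r ?invr_gt0// ler_piMr//.
      by rewrite mulr_ge0 ?exprn_ge0.
    by rewrite gerBl exprn_ge0.
  elim: k => [|k IH]; first by rewrite addn0 subrr rnorm0 expr0 subrr mulr0 mul0r.
  rewrite addnS -(subrK (u (n + k)%N) (u _.+1)) -addrA.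
  apply: le_trans (rnormD _ _) _; apply: le_trans (lerD (uq _) IH) _.
  rewrite le_eqVlt; apply/orP; left; apply/eqP.
  by rewrite exprD exprS; field; rewrite gt_eqF.
have qcvg : c * q ^+ n / (1 - q) @[n --> \oo] --> 0.
  rewrite -[X in _ --> X](mul0r (1 - q)^-1).
  by apply: cvgMl; exact: geometric_to0.
have cu : cvg (u n @[n --> \oo]).
  apply: cauchy_cvg; apply: cauchy_exP => e e0.
  have [r r0 er] : exists2 r : R, 0 < r & e = r%:C.
    exists (complex.Re e); last by rewrite RRe_real// gtr0_real.
    by move: e0; rewrite ltcE => /andP[].
  have /cvgrPdist_lt/(_ _ r0)[N _ /(_ N (leqnn _))] := qcvg.
  rewrite /= sub0r normrN => Nr.
  exists (u N); exists N => // n /= Nn.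
  rewrite -ball_normE /ball_ /= er normE ltcR rnorm_distC.
  rewrite -(subnKC Nn); apply: le_lt_trans (tail _ _) _.
  exact: le_lt_trans (ler_norm _) Nr.
exists (lim (u n @[n --> \oo])).
  by apply: (closed_cvg _ clM) cu => //; exact: nearW.
move=> n; apply/ler_addgt0Pr => e e0.
have ec : 0 < e%:C by rewrite ltcR.
have /cvgrPdist_lt/(_ _ ec)[N _ /(_ (n + N)%N (leq_addl _ _))] := cu.
rewrite /= normE ltcR => Ne.
rewrite -(subrK (u (n + N)%N) (lim _)) -addrA addrC.
apply: le_trans (rnormD _ _) _.
by apply: lerD (tail _ _) (ltW Ne).
Qed.
End RealInner.

(** * Bounded operators *)

Section Operators.
Context {R : realType} {H : hilbertType R}.
Implicit Types (A B X Y : boundedOp H) (x y z : H).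

Lemma rinner_herm A : hermitian_op A ->
  forall x y, rinner (A x) y = rinner x (A y).
Proof. by move=> hA x y; rewrite /rinner hA. Qed.

(** For a hermitian [T] the number [<T x, x>] equals its conjugate, so only its
    real part matters. *)
Lemma positive_opP (T : H -> H) : hermitian_op T ->
  positive_op T <-> forall x, 0 <= rinner (T x) x.
Proof.
move=> hT; split=> [[_ T0] x|T0]; first by have := T0 x; rewrite lecE => /andP[].
split=> // x; rewrite lecE (T0 x) andbT.
have := inner_conj (T x) x; rewrite -hT; case: '[T x, x] => a b /= [] /eqP.
by rewrite -addr_eq0 -mulr2n mulrn_eq0.
Qed.

(** The bound is taken at least 1 only so that it can be inverted and multiplied
    without case distinctions. *)
Lemma bounded_rnorm A :
  exists2 K : R, 1 <= K & forall x, rnorm (A x) <= K * rnorm x.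
Proof.
have [K AK] := op_bounded A; exists (Num.max 1 K); first by rewrite le_max lexx.
move=> x; have := AK x; rewrite !normE -rmorphM /= lecR => /le_trans; apply.
by rewrite ler_wpM2r ?rnorm_ge0// le_max lexx orbT.
Qed.

Lemma range_op A x : range A (A x). Proof. by exists x. Qed.

Lemma rangeD A x y : range A x -> range A y -> range A (x + y).
Proof. by move=> [u _ <-] [v _ <-]; rewrite -linearD. Qed.

Lemma rangeZ A (a : R[i]) x : range A x -> range A (a *: x).
Proof. by move=> [u _ <-]; rewrite -linearZ. Qed.

Lemma rangeN A x : range A x -> range A (- x).
Proof. by move=> [u _ <-]; rewrite -linearN. Qed.

(** Gliding hump.  If the bound failed, there would be unit vectors [e n] in the
    range with [A (e n)] shrinking faster than [3 ^- n].  The series of the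
    [3 ^- n *: e n], with signs chosen so that the terms do not cancel, has a
    sum [l] in the closed range with [<l, e n>] of order [3 ^- n].  But
    [l = A u], so [<l, e n> = <u, A (e n)>] is much smaller than that. *)
Lemma closed_range_bounded_below A : hermitian_op A -> closed (range A) ->
  exists2 C : R, 1 <= C & forall x, range A x -> rnorm x <= C * rnorm (A x).
Proof.
move=> hA clA; apply: contrapT => noC.
(* The second component of [p] is the partial sum built so far; it determines
   the sign of the next term. *)
have bad (p : nat * H) : exists e, [/\ range A e, rnorm e = 1,
    3 ^+ p.1 * p.1.+1%:R * rnorm (A e) <= 1 & 0 <= rinner p.2 e].
  case: p => n y /=; set D : R := 3 ^+ n * n.+1%:R.
  have [x [Ax Dx yx]] : exists x,
      [/\ range A x, D * rnorm (A x) < rnorm x & 0 <= rinner y x].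
    have [x [Ax Dx]] : exists x, range A x /\ D * rnorm (A x) < rnorm x.
      apply: contrapT => nox; apply: noC; exists D => [|x Ax].
        by rewrite mulr_ege1// ?ler1n// exprn_ege1// ler1n.
      by rewrite leNgt; apply/negP => Dx; apply: nox; exists x.
    have [yx|yx] := leP 0 (rinner y x); first by exists x.
    exists (- x); rewrite linearN !rnormN rinnerNr oppr_ge0 (ltW yx); split=> //.
    exact: rangeN.
  have D0 : 0 <= D by rewrite mulr_ge0// exprn_ge0.
  have x0 : 0 < rnorm x by apply: le_lt_trans Dx; rewrite mulr_ge0// rnorm_ge0.
  exists ((rnorm x)^-1%:C *: x); split.
  - exact: rangeZ.
  - by rewrite rnormZ ger0_norm ?invr_ge0 ?(ltW x0)// mulVf// gt_eqF.
  - rewrite linearZ /= rnormZ ger0_norm ?invr_ge0 ?(ltW x0)//.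
    by rewrite mulrCA ler_pdivrMl// mulr1 ltW.
  - by rewrite rinnerZr mulr_ge0// invr_ge0 ltW.
have [e eP] := choice bad.
pose fix w n := if n is k.+1 then w k + (3 ^- k)%:C *: e (k, w k) else 0 : H.
have [l [u _ ul] wl] : exists2 l, range A l &
    forall n, rnorm (l - w n) <= 1 * 3^-1 ^+ n / (1 - 3^-1).
  apply: geometric_cvg => //.
  - elim=> [|n IH /=]; first by exists 0 => //; rewrite linear0.
    by apply: rangeD => //; apply: rangeZ; have [] := eP (n, w n).
  - by apply/andP; split; lra.
  - move=> n; have [_ e1 _ _] := eP (n, w n).
    rewrite /= addrC addKr rnormZ e1 mulr1 mul1r exprVn.
    by rewrite ger0_norm ?lexx// invr_ge0 exprn_ge0.
have [n nu] : exists n : nat, 2 * rnorm u < n.+1%:R.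
  by exists (Num.truncn (2 * rnorm u)); rewrite truncnS_gt.
have [_ e1 Ae ye] := eP (n, w n); move: (wl n.+1) Ae => /=.
set f := e _ in e1 ye *; move=> wn Ae.
have t0 : 0 < 3 ^- n :> R by rewrite invr_gt0 exprn_gt0.
have lower : 3 ^- n <= rinner (w n.+1) f.
  by rewrite /= !rinnerE -rnorm_sqr e1 expr1n mulr1 lerDr.
(* The remaining steps sum to half of the [n]-th one, so they cannot undo it. *)
have gap : rinner (w n.+1 - l) f <= 3 ^- n / 2.
  apply: le_trans (rinner_le _ _) _; rewrite e1 mulr1 rnorm_distC.
  apply: le_trans wn _; rewrite exprVn exprS invfM.
  by rewrite (_ : 1 - 3^-1 = 2 / 3 :> R); lra.
have upper : rinner l f <= rnorm u * rnorm (A f).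
  by rewrite -ul (rinner_herm hA) rinner_le.
have : 3 ^- n / 2 <= rnorm u * rnorm (A f).
  by move: gap; rewrite rinnerDl rinnerNl; lra.
apply/negP; rewrite -ltNge.
rewrite -(ltr_pM2l (_ : 0 < 2 * 3 ^+ n)) ?mulr_gt0 ?exprn_gt0//.
rewrite (_ : 2 * 3 ^+ n * (3 ^- n / 2) = 1); last first.
  by field; rewrite expf_neq0.
have [Af0|Af0] := eqVneq (rnorm (A f)) 0; first by rewrite Af0 !mulr0.
apply: lt_le_trans Ae.
rewrite (_ : 2 * 3 ^+ n * (rnorm u * rnorm (A f)) =
             3 ^+ n * (2 * rnorm u) * rnorm (A f)); last by ring.
rewrite ltr_pM2r ?lt0r ?Af0 ?rnorm_ge0// ltr_pM2l// exprn_gt0.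
Qed.

Lemma range_kernel_disjoint A x : hermitian_op A ->
  range A x -> A x = 0 -> x = 0.
Proof.
move=> hA [u _ <-] AA; apply: rnorm_eq0; apply/eqP.
by rewrite -sqrf_eq0 rnorm_sqr (rinner_herm hA) AA /rinner linear0r.
Qed.

(** Solve [A (A l) = A y] in the range by Richardson iteration with step [t], the
    inverse square of a bound for [A]; its residuals [r n] decay geometrically.
    The square of [A] replaces [A] because [1 - t A] need not contract when the
    spectrum of [A] has both signs.  Then [A l - y] lies in the range and in the
    null space of [A], hence vanishes. *)
Lemma closed_range_onto A : hermitian_op A -> closed (range A) ->
  forall y, range A y -> exists2 m, range A m & A m = y.
Proof.
move=> hA clA y Ay.
have [C C1 AC] := closed_range_bounded_below hA clA.
have [K K1 AK] := bounded_rnorm A.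
(* The squared norm shrinks by the factor [1 - d], which is at most
   [(1 - d / 2) ^+ 2]. *)
pose t := K ^- 2; pose d := (C * K) ^- 2; pose q := 1 - d / 2.
have CK1 : 1 <= C * K by rewrite mulr_ege1.
have K0 : 0 < K ^+ 2 by rewrite exprn_gt0// (lt_le_trans _ K1).
have CK0 : 0 < (C * K) ^+ 2 by rewrite exprn_gt0// (lt_le_trans _ CK1).
have d0 : 0 < d by rewrite invr_gt0.
have d1 : d <= 1 by rewrite invf_le1// exprn_ege1.
have t0 : 0 < t by rewrite invr_gt0.
have q0 : 0 <= q by rewrite /q; lra.
have contr m : range A m -> rnorm (m - t%:C *: A (A m)) <= q * rnorm m.
  move=> Am; rewrite -ler_sqr ?nnegrE ?mulr_ge0 ?rnorm_ge0//.
  have -> : rnorm (m - t%:C *: A (A m)) ^+ 2 = rnorm m ^+ 2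
      - 2 * t * rnorm (A m) ^+ 2 + t ^+ 2 * rnorm (A (A m)) ^+ 2.
    rewrite !rnorm_sqr !rinnerE (rinnerC m) (rinner_herm hA (A m) m); ring.
  have step : t ^+ 2 * rnorm (A (A m)) ^+ 2 <= t * rnorm (A m) ^+ 2.
    rewrite expr2 -mulrA ler_pM2l// mulrC ler_pdivrMr// mulrC -exprMn.
    by rewrite ler_sqr ?nnegrE ?mulr_ge0 ?rnorm_ge0// (le_trans _ K1).
  have gain : d * rnorm m ^+ 2 <= t * rnorm (A m) ^+ 2.
    have -> : d = t * C ^- 2 by rewrite /d exprMn invfM mulrC.
    rewrite -mulrA ler_pM2l// mulrC.
    rewrite ler_pdivrMr ?exprn_gt0 ?(lt_le_trans _ C1)// mulrC -exprMn.
    by rewrite ler_sqr ?nnegrE ?mulr_ge0 ?rnorm_ge0 ?AC// (le_trans _ C1).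
  have : (1 - d) * rnorm m ^+ 2 <= q ^+ 2 * rnorm m ^+ 2.
    by rewrite ler_wpM2r ?sqr_ge0// /q; nra.
  by rewrite exprMn; lra.
pose fix r n := if n is k.+1 then r k - t%:C *: A (A (r k)) else A y.
pose fix w n := if n is k.+1 then w k + t%:C *: r k else 0 : H.
have rA n : range A (r n).
  elim: n => [|n IH /=]; first exact: range_op.
  by apply: rangeD => //; apply/rangeN/rangeZ/range_op.
have rq n : rnorm (r n) <= rnorm (A y) * q ^+ n.
  elim: n => [|n IH /=]; first by rewrite expr0 mulr1.
  apply: le_trans (contr _ (rA n)) _.
  by rewrite exprS mulrCA ler_wpM2l.
have rE n : r n = A (y - A (w n)).
  elim: n => [|n IH /=]; first by rewrite linear0 subr0.
  rewrite [A (w n + _)]linearD [A (_ *: _)]linearZ opprD addrA.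
  by rewrite [in RHS]linearB -IH /= [A (_ *: _)]linearZ.
have [l Al lw] : exists2 l, range A l &
    forall n, rnorm (l - w n) <= t * rnorm (A y) * q ^+ n / (1 - q).
  apply: geometric_cvg => //.
  - elim=> [|n IH /=]; first by exists 0 => //; rewrite linear0.
    by apply: rangeD => //; apply: rangeZ.
  - by rewrite q0 /q; lra.
  - by move=> n /=; rewrite addrC addKr rnormZ gtr0_norm// -mulrA ler_pM2l.
exists l => //; apply/eqP; rewrite -subr_eq0 -oppr_eq0 opprB; apply/eqP.
apply: (range_kernel_disjoint hA).
  by apply: rangeD => //; apply: rangeN; exact: range_op.
have bound n : rnorm (A (y - A l)) <=
    (rnorm (A y) + K ^+ 2 * (t * rnorm (A y) / (1 - q))) * q ^+ n.
  have -> : A (y - A l) = r n - A (A (l - w n)).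
    by rewrite rE -linearB /= [A (l - _)]linearB opprB addrA subrK.
  apply: le_trans (rnormD _ _) _; rewrite rnormN mulrDl; apply: lerD => //.
  apply: le_trans (AK _) _; rewrite expr2 -!mulrA ler_wpM2l ?(le_trans _ K1)//.
  apply: le_trans (AK _) _; rewrite ler_wpM2l ?(le_trans _ K1)//.
  by apply: le_trans (lw n) _; rewrite -!mulrA (mulrC (q ^+ n)).
apply: rnorm_eq0; apply/eqP; rewrite eq_le rnorm_ge0 andbT.
have q1 : 0 <= q < 1 by rewrite q0 /q; lra.
exact: le_geometric_le0 q1 bound.
Qed.

(** * Moore-Penrose inverses of hermitian operators *)

(** The value [f x] at [x] is the unique [m] in the range with
    [A (A m) = A x].  Uniqueness makes [f] linear and makes it commute with [A],
    from which the four defining equations follow. *)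
Lemma hermitian_mpinv_exists A : hermitian_op A -> closed (range A) ->
  exists X, is_mpinv A X.
Proof.
move=> hA clA.
have [C C1 AC] := closed_range_bounded_below hA clA.
have [K K1 AK] := bounded_rnorm A.
have inj m m' : range A m -> range A m' -> A (A m) = A (A m') -> m = m'.
  move=> Am Am' AA; apply/eqP; rewrite -subr_eq0; apply/eqP.
  have mm' : range A (m - m') by apply: rangeD => //; exact: rangeN.
  apply: (range_kernel_disjoint hA) => //; apply: (range_kernel_disjoint hA).
    exact: range_op.
  by rewrite !linearB AA subrr.
have /choice[f fP] x : exists m, range A m /\ A (A m) = A x.
  have [p Ap <-] := closed_range_onto hA clA (range_op A x).
  by have [m Am <-] := closed_range_onto hA clA Ap; exists m.
have fA x : range A (f x) by case: (fP x).
have fE x : A (A (f x)) = A x by case: (fP x).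
have f_linear : linear f.
  move=> a x y; apply: inj => //; first by apply: rangeD => //; exact: rangeZ.
  by rewrite fE !(linearD, linearZ) /= !fE.
pose F : {linear H -> H} := HB.pack f (GRing.isLinear.Build _ _ _ _ _ f_linear).
have F_bounded : exists M : R, forall x, `|F x| <= M%:C * `|x|.
  exists (C * (C * K)) => x; rewrite !normE -rmorphM lecR -!mulrA.
  have C0 : 0 <= C by exact: le_trans C1.
  apply: le_trans (AC _ (fA x)) _; rewrite ler_wpM2l//.
  apply: le_trans (AC _ (range_op A _)) _; rewrite ler_wpM2l//.
  by rewrite fE.
have fAC x : f (A x) = A (f x).
  by apply: inj; [exact: fA|exact: range_op|rewrite !fE].
have proj x y : '[A (f x), y] = '[A (f x), A (f y)].
  by rewrite !hA fE.
exists (BoundedOp F_bounded); split=> x /=.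
- by rewrite fAC fE.
- by apply: inj; [exact: fA|exact: fA|rewrite fE].
- by move=> y /=; rewrite proj (inner_conj x) (proj y) -inner_conj.
- by move=> y /=; rewrite !fAC proj (inner_conj x) (proj y) -inner_conj.
Qed.

Lemma is_mpinv_sym A X : is_mpinv A X -> is_mpinv X A.
Proof. by case. Qed.

Section MoorePenrose.
Variables A X : boundedOp H.
Hypotheses (hA : hermitian_op A) (AX : is_mpinv A X).

Lemma mpinvK x : A (X (A x)) = A x. Proof. by case: AX => + _ _ _; apply. Qed.

Lemma mpinvKV x : X (A (X x)) = X x. Proof. by case: AX => _ + _ _; apply. Qed.

(** Taking adjoints in [A X A = A] gives [A A X = A = X A A], so both products
    equal [X A A X]. *)
Lemma mpinv_comm x : A (X x) = X (A x).
Proof.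
have [_ _ hAX hXA] := AX; move: hAX hXA; rewrite /hermitian_op /= => hAX hXA.
have AAX z : A (A (X z)) = A z.
  by apply: inner_inj => y; rewrite hA hAX mpinvK hA.
have XAA z : X (A (A z)) = A z.
  by apply: inner_inj => y; rewrite hXA hA mpinvK hA.
by rewrite -(XAA (X x)) AAX.
Qed.

Lemma mpinv_hermitian : hermitian_op X.
Proof.
have [_ _ hAX _] := AX; move: hAX; rewrite /hermitian_op /= => hAX x y.
by rewrite -{1}mpinvKV -mpinv_comm hAX -hA hAX mpinv_comm mpinvKV.
Qed.

Lemma mpinv_null x : A x = 0 -> X x = 0.
Proof. by move=> Ax; rewrite -mpinvKV mpinv_comm Ax !linear0. Qed.

End MoorePenrose.

(** * Order reversal *)

(** [<X x, x> = <A (X x), X x>]. *)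
Lemma mpinv_positive A X : positive_op A -> is_mpinv A X -> positive_op X.
Proof.
move=> [hA A0] AX; have hX := mpinv_hermitian hA AX; split=> // x.
by rewrite -(mpinvKV AX x) hX; exact: A0.
Qed.

(** The hypotheses force [<A x, x> = 0].  Then the form of [A] at [x - t A x] is
    [- 2 t |A x|^2 + O(t^2)], which is nonnegative for small [t] only if
    [A x = 0]. *)
Lemma loewner_null A B x :
  positive_op A -> loewner A B -> B x = 0 -> A x = 0.
Proof.
move=> [hA A0] [_ BA] Bx.
have [K K1 AK] := bounded_rnorm A.
have K0 : 0 < K by exact: lt_le_trans K1.
have /eqP Axx : rinner (A x) x == 0.
  rewrite eq_le (positive_opP hA).1// andbT.
  have := BA x; rewrite /= Bx sub0r linearNl oppr_ge0 lecE => /andP[_].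
  by [].
have := (positive_opP hA).1 (conj hA A0) (x - K^-1%:C *: A x).
rewrite linearB linearZ /= !rinnerE Axx.
rewrite (rinner_herm hA (A x) x) -!rnorm_sqr => ineq.
have AAx : rinner (A (A x)) (A x) <= K * rnorm (A x) ^+ 2.
  by rewrite expr2 mulrA (le_trans (rinner_le _ _))// ler_wpM2r ?rnorm_ge0.
apply: rnorm_eq0; apply/eqP; rewrite -sqrf_eq0 eq_le sqr_ge0 andbT.
have : K^-1 * (K^-1 * rinner (A (A x)) (A x)) <= K^-1 * rnorm (A x) ^+ 2.
  by rewrite ler_pM2l ?invr_gt0// ler_pdivrMl.
by move=> le2; rewrite -(pmulr_rle0 _ (_ : 0 < K^-1)) ?invr_gt0//; lra.
Qed.

(** The hypotheses make the null spaces equal, hence [A X = B Y]; the conclusion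
    then comes from the form of [A] at [Y x - X x]. *)
Lemma loewner_mpinv A B X Y : positive_op A -> hermitian_op B ->
  is_mpinv A X -> is_mpinv B Y -> loewner A B ->
  (forall x, A x = 0 -> B x = 0) -> loewner Y X.
Proof.
move=> pA hB AX BY AB nAB; have [hA _] := pA.
have [hX hY] := (mpinv_hermitian hA AX, mpinv_hermitian hB BY).
(* Each of the projections [A X] and [B Y] absorbs the other on the right;
   taking adjoints in one of these identities shows that they coincide. *)
have same x : A (X x) = B (Y x).
  have AB' z : A (X (B (Y z))) = A (X z).
    rewrite !(mpinv_comm hA AX); congr (X _); apply/esym/eqP.
    rewrite -subr_eq0 -linearB; apply/eqP/(loewner_null pA AB).
    by rewrite linearB (mpinv_comm hB BY) (mpinvK BY) subrr.
  have BA' z : B (Y (A (X z))) = B (Y z).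
    rewrite !(mpinv_comm hB BY); congr (Y _); apply/esym/eqP.
    rewrite -subr_eq0 -linearB; apply/eqP/nAB.
    by rewrite linearB (mpinv_comm hA AX) (mpinvK AX) subrr.
  have [_ _ hAX _] := AX; have [_ _ hBY _] := BY.
  move: hAX hBY; rewrite /hermitian_op /= => hAX hBY.
  by apply: inner_inj => y; rewrite hAX -AB' -hAX -hBY BA'.
have hXY : hermitian_op (X \- Y).
  by move=> x y; rewrite /= linearBl linearBr /= hX hY.
apply/(positive_opP hXY) => x /=.
have quad := (positive_opP hA).1 pA (Y x - X x).
have ABu := (positive_opP AB.1).1 AB (Y x).
have qX : rinner (X x) x = rinner (A (X x)) (X x).
  rewrite (rinner_herm hA) (rinnerC (X x) (A _)) -{1}(mpinvKV AX x).
  by rewrite (rinner_herm hX).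
have qY : rinner (Y x) x = rinner (B (Y x)) (Y x).
  by rewrite -{1}(mpinvKV BY x) (rinner_herm hY).
move: quad ABu; rewrite /= linearB !rinnerE /= qX qY.
rewrite (rinner_herm hA (Y x) (X x)) (rinnerC (Y x)) same.
lra.
Qed.

(** Split [x] in [N(A)] along [B]: the component [x - B (Y x)] lies in [N(B)],
    hence in [N(A)], so [B (Y x)] lies in [R(B)] and in [N(A)]. *)
Lemma loewner_null_sub A B Y : positive_op A -> hermitian_op B ->
  is_mpinv B Y -> loewner A B -> range B `&` nullspace A `<=` [set 0] ->
  forall x, A x = 0 -> B x = 0.
Proof.
move=> pA hB BY AB cap0 x Ax.
suff BYx : B (Y x) = 0 by rewrite -(mpinvK BY) -(mpinv_comm hB BY) BYx linear0.
apply: cap0; split; first exact: range_op.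
have /(loewner_null pA AB) : B (B (Y x) - x) = 0.
  by rewrite linearB (mpinv_comm hB BY) (mpinvK BY) subrr.
by rewrite linearB /= Ax subr0.
Qed.

Lemma mpinv_range A X : hermitian_op A -> is_mpinv A X -> range X `<=` range A.
Proof.
move=> hA AX _ [x _ <-]; exists (X (X x)) => //.
by rewrite (mpinv_comm hA AX) (mpinvKV AX).
Qed.

End Operators.

Unset Implicit Arguments.

Theorem theorem4p1 (R : realType) (H : hilbertType R) (A B : boundedOp H)
    (posA : positive_op A) (posB : positive_op B)
    (clA : closed (range A)) (clB : closed (range B)) :
  let c1 := loewner A B in
  let c2 := loewner (mpinv B) (mpinv A) in
  let c3 := range A `&` nullspace B = [set 0] /\
            range B `&` nullspace A = [set 0] in
  [/\ c1 /\ c2 -> c3, c1 /\ c3 -> c2 & c2 /\ c3 -> c1].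
Proof.
have [[hA _] [hB _]] := (posA, posB).
have [X AX] := hermitian_mpinv_exists hA clA.
have [Y BY] := hermitian_mpinv_exists hB clB.
rewrite (mpinvE AX) (mpinvE BY) => c1 c2 c3.
have [posX posY] := (mpinv_positive posA AX, mpinv_positive posB BY).
have [XA YB] := (is_mpinv_sym AX, is_mpinv_sym BY).
split.
- move=> [AB YX].
  have cap0 (S T : boundedOp H) : hermitian_op S ->
      (forall x, T x = 0 -> S x = 0) -> range S `&` nullspace T = [set 0].
    move=> hS TS; apply/seteqP; split=> x /=.
      by move=> [Sx /TS]; exact: range_kernel_disjoint.
    by move=> ->; split; [exists 0; rewrite ?linear0|exact: linear0].
  split; apply: cap0 => // x; first exact: loewner_null.
  move=> /(mpinv_null hA AX) /(loewner_null posY YX).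
  exact: mpinv_null posY.1 YB _.
- move=> [AB [_ cap0]]; apply: (loewner_mpinv posA hB AX BY AB).
  by apply: (loewner_null_sub posA hB BY AB); rewrite cap0.
- move=> [YX [cap0 _]]; apply: (loewner_mpinv posY posX.1 YB XA YX).
  apply: (loewner_null_sub posY posX.1 XA YX) => x [/(mpinv_range hA AX) Ax Yx].
  rewrite -cap0; split=> //; exact: mpinv_null posY.1 YB _ Yx.
Qed.
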